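(* Let $\widehat{\mathbf c}=(c_1,c_2,c_3)\in\mathbb{R}^3$, $M=\{(x,y,z)\in\mathbb{R}^3: z\neq c_3\}$, $N=\mathbb{R}^2$, and let $\Pi_{\widehat{\mathbf c}}\colon M\to N$ be the central projection centered at $\widehat{\mathbf c}$, $$\Pi_{\widehat{\mathbf c}}(x,y,z)=\left(\frac{x-c_1}{z-c_3}+c_1,\ \frac{y-c_2}{z-c_3}+c_2\right).$$ If $I\colon J^k(N,1)\to\mathbb{R}$ is a differential invariant for the projective action of $\mathrm{PGL}(3)$ on $N$, then $\widehat I=I\circ\Pi_{\widehat{\mathbf c}}^{(k)}\colon J^k(M,1)\to\mathbb{R}$ is a differential invariant for the translational conjugation $\mathrm{GL}(3)_{\widehat{\mathbf c}}:=\operatorname{Ad}T_{\widehat{\mathbf c}}\,(\mathrm{GL}(3))=T_{\widehat{\mathbf c}}\,\mathrm{GL}(3)\,T_{\widehat{\mathbf c}}^{-1}$ of the centro-affine action.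
   Context: $T_{\widehat{\mathbf c}}$ is translation of $\mathbb{R}^3$ by $\widehat{\mathbf c}$; the centro-affine action is the linear action of $\mathrm{GL}(3)$ on $\mathbb{R}^3$, and $\mathrm{GL}(3)_{\widehat{\mathbf c}}$ acts (locally) on $M$ by the transformations $T_{\widehat{\mathbf c}}AT_{\widehat{\mathbf c}}^{-1}$, $A\in\mathrm{GL}(3)$. The projective action of $\mathrm{PGL}(3)=\mathrm{GL}(3)/\{\lambda\,\mathrm{I}:0\ne\lambda\in\mathbb{R}\}$ on $N=\mathbb{R}^2$ is the local linear fractional action $$(X,Y)\mapsto\left(\frac{a_{11}X+a_{12}Y+a_{13}}{a_{31}X+a_{32}Y+a_{33}},\ \frac{a_{21}X+a_{22}Y+a_{23}}{a_{31}X+a_{32}Y+a_{33}}\right),\qquad A=(a_{ij})\in\mathrm{GL}(3).$$ $J^k(M,1)$ and $J^k(N,1)$ are the spaces of $k$-jets of curves in $M$ and $N$. Group elements act on jets by prolongation, $g^{(k)}\cdot \mathrm{j}_kS|_z=\mathrm{j}_k(g\cdot S)|_{g\cdot z}$. $\Pi_{\widehat{\mathbf c}}^{(k)}$ maps the $k$-jet at $w$ of a curve $S\subset M$ transversal to the fibers of $\Pi_{\widehat{\mathbf c}}$ to the $k$-jet of $\Pi_{\widehat{\mathbf c}}(S)$ at $\Pi_{\widehat{\mathbf c}}(w)$; it is defined on the open dense subset of $J^k(M,1)$ of jets of such curves. Functions written $J^k\to\mathbb{R}$ may be defined only on open subsets; $\widehat I$ has domain $(\Pi_{\widehat{\mathbf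 c}}^{(k)})^{-1}(\operatorname{dom}I)$. A differential invariant is a function $I$ with $I(g^{(k)}\cdot z^{(k)})=I(z^{(k)})$ whenever $g^{(k)}\cdot z^{(k)}$ is defined and both $z^{(k)}$ and $g^{(k)}\cdot z^{(k)}$ lie in $\operatorname{dom}I$. *)

(* Defs.v *)
From HB Require Import structures.
From mathcomp Require Import all_boot all_order all_algebra.
From mathcomp Require Import all_classical all_reals all_analysis.

Set Implicit Arguments.
Unset Strict Implicit.
Unset Printing Implicit Defensive.

Import Order.TTheory GRing.Theory Num.Theory.
Import numFieldNormedType.Exports.

Local Open Scope classical_set_scope.
Local Open Scope ring_scope.

Section Jets.
Context {R : realType}.

Definition smooth_near0 (f : R -> R) : Prop :=
  \forall t \near (0 : R), forall j : nat, derivable (derive1n j f) t 1.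

Definition diffeo_germ (phi : R -> R) : Prop :=
  exists psi : R -> R,
    [/\ phi 0 = 0 /\ psi 0 = 0, smooth_near0 phi, smooth_near0 psi,
        \forall t \near (0 : R), psi (phi t) = t
      & \forall t \near (0 : R), phi (psi t) = t].

Section Curves.
Context {n : nat}.
Implicit Types (g d : R -> 'cV[R]_n) (X : set 'cV[R]_n).

Definition coord g (i : 'I_n) : R -> R := fun t => g t i 0.

Definition smooth_curve g : Prop := forall i, smooth_near0 (coord g i).

Definition velocity g : 'cV[R]_n := \col_i derive1 (coord g i) 0.

(* Curves are considered near a point, through a regular smooth
   parametrization sending the parameter 0 to that point; the values of g away
   from 0 are irrelevant. *)
Definition regular_curve g : Prop := smooth_curve g /\ velocity g != 0.

Definition curve_in X g : Prop :=
  regular_curve g /\ \forall t \near (0 : R), X (g t).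

(* Row j is the j-th derivative at 0, for 0 <= j <= k. *)
Definition taylor (k : nat) g : 'M[R]_(k.+1, n) :=
  \matrix_(j, i) derive1n j (coord g i) 0.

(* Contact of order k at g 0 = d 0 of the unparametrized curves. *)
Definition contact (k : nat) g d : Prop :=
  exists2 phi, diffeo_germ phi & taylor k (g \o phi) = taylor k d.

(* j_k S at g 0, where S is the curve parametrized by g: a k-jet is a class of
   curves having contact of order k. *)
Definition jet (k : nat) g : set (R -> 'cV[R]_n) :=
  [set d | regular_curve d /\ contact k g d].

(* J^k(X, 1), for X open. *)
Definition jet_space (k : nat) X : set (set (R -> 'cV[R]_n)) :=
  [set jet k g | g in curve_in X].

(* The topology of the jet space is the quotient of that of the space of
   derivatives (g(0), g'(0), ..., g^(k)(0)) of regular parametrizations. *)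
Definition jet_open (k : nat) (D : set (set (R -> 'cV[R]_n))) : Prop :=
  open [set A : 'M[R]_(k.+1, n) |
    exists g, [/\ regular_curve g, taylor k g = A & D (jet k g)]].

End Curves.

Section Prolongation.
Context {m n : nat}.
Implicit Types (P : set (R -> 'cV[R]_m)) (F : 'cV[R]_m -> 'cV[R]_n).

(* F, applied to the curves satisfying P, maps the k-jet z to the k-jet w. *)
Definition prolongs (k : nat) P F (z : set (R -> 'cV[R]_m))
    (w : set (R -> 'cV[R]_n)) : Prop :=
  exists g, [/\ regular_curve g, P g, z = jet k g & w = jet k (F \o g)].

Definition prolong_defined (k : nat) P F (z : set (R -> 'cV[R]_m)) : Prop :=
  exists w, prolongs k P F z w.

(* The default value set0, which is not a jet, is taken exactly where the
   prolongation is not defined. *)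
Definition prolong (k : nat) P F (z : set (R -> 'cV[R]_m)) :
    set (R -> 'cV[R]_n) :=
  xget set0 [set w | prolongs k P F z w].

(* v is tangent at p to the fiber of F : X -> R^n through p. *)
Definition tangent_to_fiber (X : set 'cV[R]_m) F (p v : 'cV[R]_m) : Prop :=
  exists d, [/\ smooth_curve d, d 0 = p, velocity d = v
    & \forall t \near (0 : R), X (d t) /\ F (d t) = F p].

Definition transversal_in (X : set 'cV[R]_m) F (g : R -> 'cV[R]_m) : Prop :=
  curve_in X g /\ ~ tangent_to_fiber X F (g 0) (velocity g).

End Prolongation.

Record local_transf (n : nat) := LocalTransf {
  ldom : set 'cV[R]_n;
  lmap : 'cV[R]_n -> 'cV[R]_n }.

Section Invariants.
Context {n : nat}.

Definition defined_on_curve (a : local_transf n) : set (R -> 'cV[R]_n) :=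
  [set g | ldom a (g 0)].

(* I : J^k(X, 1) -> R, with open domain D, is a differential invariant of the
   set G of local transformations of X; the values of I outside D are
   irrelevant. *)
Definition differential_invariant (k : nat) (X : set 'cV[R]_n)
    (G : set (local_transf n)) (D : set (set (R -> 'cV[R]_n)))
    (I : set (R -> 'cV[R]_n) -> R) : Prop :=
  [/\ D `<=` jet_space k X, jet_open k D
    & forall a z, G a ->
        prolong_defined k (defined_on_curve a) (lmap a) z ->
        D z -> D (prolong k (defined_on_curve a) (lmap a) z) ->
        I (prolong k (defined_on_curve a) (lmap a) z) = I z].

End Invariants.

Definition GL3 : set 'M[R]_3 := [set A | A \in unitmx].

Definition linfrac_den (A : 'M[R]_3) (p : 'cV[R]_2) : R :=
  A 2 0 * p 0 0 + A 2 1 * p 1 0 + A 2 2.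

Definition linfrac (A : 'M[R]_3) (p : 'cV[R]_2) : 'cV[R]_2 :=
  \col_(i < 2)
    (if i == 0
     then (A 0 0 * p 0 0 + A 0 1 * p 1 0 + A 0 2) / linfrac_den A p
     else (A 1 0 * p 0 0 + A 1 1 * p 1 0 + A 1 2) / linfrac_den A p).

(* The projective action on the plane; nonzero multiples of a matrix give the
   same local transformation, so that this is PGL(3). *)
Definition PGL3 : set (local_transf 2) :=
  [set LocalTransf [set p | linfrac_den A p != 0] (linfrac A) | A in GL3].

Definition translation (c : 'cV[R]_3) : 'cV[R]_3 -> 'cV[R]_3 :=
  fun p => p + c.

(* T_c A T_c^-1, with T_c^-1 = T_(-c). *)
Definition Ad_translation (c : 'cV[R]_3) (A : 'M[R]_3) :
    'cV[R]_3 -> 'cV[R]_3 :=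
  translation c \o mulmx A \o translation (- c).

Definition offplane (c : 'cV[R]_3) : set 'cV[R]_3 :=
  [set p | p 2 0 != c 2 0].

(* GL(3)_c acting locally on M = offplane c: a point of M whose image is not
   in M is outside the domain. *)
Definition GL3_conj (c : 'cV[R]_3) : set (local_transf 3) :=
  [set LocalTransf [set p | offplane c p /\ offplane c (Ad_translation c A p)]
     (Ad_translation c A) | A in GL3].

Definition central_proj (c p : 'cV[R]_3) : 'cV[R]_2 :=
  \col_(i < 2)
    (if i == 0
     then (p 0 0 - c 0 0) / (p 2 0 - c 2 0) + c 0 0
     else (p 1 0 - c 1 0) / (p 2 0 - c 2 0) + c 1 0).

Definition transversal_curves (c : 'cV[R]_3) : set (R -> 'cV[R]_3) :=
  transversal_in (offplane c) (central_proj c).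

Definition proj_jet_defined (k : nat) (c : 'cV[R]_3) :
    set (set (R -> 'cV[R]_3)) :=
  prolong_defined k (transversal_curves c) (central_proj c).

Definition proj_jet (k : nat) (c : 'cV[R]_3) :
    set (R -> 'cV[R]_3) -> set (R -> 'cV[R]_2) :=
  prolong k (transversal_curves c) (central_proj c).

End Jets.

Arguments GL3 : clear implicits.
Arguments PGL3 : clear implicits.

(* Main.v *)
Require Import Defs.
From mathcomp Require Import all_boot all_order all_algebra.
From mathcomp Require Import all_classical all_reals all_analysis.
From mathcomp Require Import ring.
Set Implicit Arguments.
Unset Strict Implicit.
Unset Printing Implicit Defensive.

Import Order.TTheory GRing.Theory Num.Theory.
Import numFieldNormedType.Exports.
Local Open Scope classical_set_scope.
Local Open Scope ring_scope.

Local Notation coord := Defs.coord.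

(** Adding a third coordinate 1 to a point of the plane turns a linear fractional
    map into a linear one, and turns the central projection into the translation
    by [- c], followed by the unipotent matrix [shear c] and a rescaling. Hence
    [Pi_c] intertwines [T_c A T_c^-1] with the linear fractional map of
    [shear c * A * (shear c)^-1], and the invariance of [I] passes to the
    composition with [Pi_c], once prolongations are known to be well defined on
    jets: for maps with rational components, derivatives of order at most [k] at 0
    of an image curve depend only on those of the curve, by induction on [k] from
    the product, inverse and chain rules.

    The same induction, run along a filter, shows that this dependence is
    continuous. Openness of the domain then follows by adding to a transversal
    curve a polynomial with prescribed small Taylor coefficients: transversality
    means that the projected curve has nonzero velocity, an open condition. *)

(** * Smooth functions near 0 *)

Section CnOn.
Context {R : realType}.
Implicit Types (U V : set R) (f g : R -> R) (n : nat).

(** The recursion differentiates first, opposite to [derive1n], so that closure under sums, products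
    and composition follows by induction on the order with the function generalized. *)
Fixpoint Cn_on U n f : Prop :=
  if n is n'.+1 then (forall t, U t -> derivable f t 1) /\ Cn_on U n' (derive1 f)
  else True.

Lemma derive1nSr n f : derive1n n.+1 f = derive1n n (derive1 f).
Proof. by rewrite /derive1n iterSr. Qed.

Lemma Cn_onP U f :
  (forall t, U t -> forall j, derivable (derive1n j f) t 1) <->
  (forall n, Cn_on U n f).
Proof.
split=> [H n|H t Ut j].
  elim: n f H => //= n IHn f H; split=> [t Ut|]; first exact: (H t Ut 0%N).
  by apply: IHn => t Ut j; rewrite -derive1nSr; exact: H.
elim: j f H => [|j IHj] f H; first exact: (H 1%N).1.
by rewrite derive1nSr; apply: IHj => n; have [] := H n.+1.
Qed.

Lemma eq_on_derive1 U f g t : open U -> (forall t, U t -> f t = g t) -> U t ->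
  derive1 f t = derive1 g t.
Proof.
move=> oU fg Ut; rewrite !derive1E; apply: near_eq_derive.
by near=> s; apply: fg; near: s; exact: open_nbhs_nbhs.
Unshelve. all: by end_near. Qed.

(** The differentiation rules hold only on [U]. Since [U] is open, equality on [U] passes to
    derivatives, so the formula given by a rule can stand for the true derivative. *)
Lemma eq_Cn_on U n f g : open U -> (forall t, U t -> f t = g t) ->
  Cn_on U n f -> Cn_on U n g.
Proof.
move=> oU; elim: n f g => //= n IHn f g fg [df Cf]; split=> [t Ut|].
  apply: near_eq_derivable (df t Ut).
  by near=> s; apply: fg; near: s; exact: open_nbhs_nbhs.
by apply: IHn Cf => t Ut; exact: eq_on_derive1 Ut.
Unshelve. all: by end_near. Qed.

Lemma Cn_onS U n f : Cn_on U n.+1 f -> Cn_on U n f.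
Proof.
elim: n f => //= n IHn f [df Cf]; split=> //; exact: IHn.
Qed.

Lemma sub_Cn_on U V n f : U `<=` V -> Cn_on V n f -> Cn_on U n f.
Proof.
move=> UV; elim: n f => //= n IHn f [df Cf].
by split=> [t Ut|]; [exact/df/UV|exact: IHn].
Qed.

Lemma Cn_on_cst U n (a : R) : Cn_on U n (cst a).
Proof.
elim: n a => //= n IHn a; split=> [t _|]; first exact: derivable_cst.
by rewrite (_ : derive1 _ = cst (0 : R)) //; apply/funext => t; rewrite derive1_cst.
Qed.

Lemma Cn_on_id U n : Cn_on U n id.
Proof.
case: n => //= n; split=> [t _|]; first exact: derivable_id.
rewrite (_ : derive1 _ = cst (1 : R)); first exact: Cn_on_cst.
by apply/funext => t; rewrite derive1E derive_id.
Qed.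

Lemma derive1D f g t : derivable f t 1 -> derivable g t 1 ->
  derive1 (f \+ g) t = derive1 f t + derive1 g t.
Proof.
move=> df dg; have H := @deriveD R R R f g t 1 df dg.
rewrite derive1E [X in _ = X + _]derive1E [X in _ = _ + X]derive1E.
exact: H.
Qed.

Lemma derive1M f g t : derivable f t 1 -> derivable g t 1 ->
  derive1 (f \* g) t = derive1 f t * g t + f t * derive1 g t.
Proof.
move=> df dg; have H := @deriveM R R f g t 1 df dg.
rewrite derive1E [X in _ = X * _ + _]derive1E [X in _ = _ + _ * X]derive1E.
rewrite addrC [_ * g t]mulrC; exact: H.
Qed.

Lemma derive1V f t : f t != 0 -> derivable f t 1 ->
  derive1 (fun s => (f s)^-1) t = - derive1 f t * ((f t)^-1 * (f t)^-1).
Proof.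
move=> f0 df; rewrite !derive1E deriveV //=.
by rewrite -exprVn expr2 scaleNr mulNr -[_ *: _]/(_ * _) mulrC.
Qed.

Lemma derive1_compR f g t : derivable g t 1 -> derivable f (g t) 1 ->
  derive1 (f \o g) t = derive1 f (g t) * derive1 g t.
Proof. by move=> dg df; have H := @derive1_comp R g f t dg df; exact: H. Qed.

Lemma Cn_onD U n f g : open U ->
  Cn_on U n f -> Cn_on U n g -> Cn_on U n (f \+ g).
Proof.
move=> oU; elim: n f g => //= n IHn f g [df Cf] [dg Cg]; split=> [t Ut|].
  by apply: derivableD; auto.
apply: (@eq_Cn_on _ _ (derive1 f \+ derive1 g)) => [//|t Ut|]; last exact: IHn.
by rewrite derive1D //=; auto.
Qed.

Lemma Cn_onM U n f g : open U ->
  Cn_on U n f -> Cn_on U n g -> Cn_on U n (f \* g).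
Proof.
move=> oU; elim: n f g => // n IHn f g Cf Cg.
have [[df Cf'] [dg Cg']] := (Cf, Cg); split=> [t Ut|].
  by apply: derivableM; auto.
apply: (@eq_Cn_on _ _ ((derive1 f \* g) \+ (f \* derive1 g))) => [//|t Ut|].
  by rewrite derive1M //=; auto.
by apply: Cn_onD => //; apply: IHn => //; exact: Cn_onS.
Qed.

Lemma Cn_onV U n f : open U -> (forall t, U t -> f t != 0) ->
  Cn_on U n f -> Cn_on U n (fun t => (f t)^-1).
Proof.
move=> oU f0; elim: n => // n IHn Cf.
have [df Cf'] := Cf; split=> [t Ut|].
  by apply: derivableV; auto.
(* The derivative -f' (1/f)^2 contains 1/f itself, which the induction hypothesis supplies at order
   [n]. *)
have CV := IHn (Cn_onS Cf).
apply: (@eq_Cn_on _ _ ((cst (-1) \* derive1 f) \*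
  ((fun t => (f t)^-1) \* (fun t => (f t)^-1)))) => [//|t Ut|].
  by rewrite derive1V /= ?mulN1r; auto.
by apply: (Cn_onM oU); apply: (Cn_onM oU) => //; exact: Cn_on_cst.
Qed.

Lemma Cn_on_comp U V n f g : open U -> (forall t, U t -> V (g t)) ->
  Cn_on V n f -> Cn_on U n g -> Cn_on U n (f \o g).
Proof.
move=> oU gUV; elim: n f => // n IHn f Cf Cg.
have [[df Cf'] [dg Cg']] := (Cf, Cg); split=> [t Ut|].
  by apply/derivable1_diffP/differentiable_comp; apply/derivable1_diffP; auto.
apply: (@eq_Cn_on _ _ ((derive1 f \o g) \* derive1 g)) => [//|t Ut|].
  rewrite (@derive1_comp R g f t) //; auto.
by apply: Cn_onM => //; apply: IHn => //; exact: Cn_onS.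
Qed.

End CnOn.

Section SmoothNear0.
Context {R : realType}.
Implicit Types (f g : R -> R) (n : nat).

Lemma near0_open_nbhs (P : R -> Prop) : (\forall t \near (0 : R), P t) ->
  exists2 U : set R, open_nbhs 0 U & forall t, U t -> P t.
Proof. by rewrite /prop_near1 nbhsE => -[U ? ?]; exists U. Qed.

Lemma smooth_near0P f : smooth_near0 f <->
  exists2 U : set R, open_nbhs 0 U & forall n, Cn_on U n f.
Proof.
split=> [|[U U0 /Cn_onP H]]; last exact: filterS H (open_nbhs_nbhs U0).
move=> /near0_open_nbhs[U U0 UP].
by exists U => //; apply/Cn_onP.
Qed.

Lemma smooth_near0_cst (a : R) : smooth_near0 (cst a).
Proof.
apply/smooth_near0P; exists setT; last by move=> n; exact: Cn_on_cst.
by split=> //; exact: openT.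
Qed.

Lemma smooth_near0_id : smooth_near0 (@id R).
Proof.
apply/smooth_near0P; exists setT; last by move=> n; exact: Cn_on_id.
by split=> //; exact: openT.
Qed.

Lemma smooth_near0D f g :
  smooth_near0 f -> smooth_near0 g -> smooth_near0 (f \+ g).
Proof.
move=> /smooth_near0P[U U0 fU] /smooth_near0P[V V0 gV]; apply/smooth_near0P.
exists (U `&` V); first exact: open_nbhsI.
move=> n; apply: Cn_onD; first by apply: openI; [case: U0|case: V0].
  by apply: sub_Cn_on (fU n); exact: subIsetl.
by apply: sub_Cn_on (gV n); exact: subIsetr.
Qed.

Lemma smooth_near0M f g :
  smooth_near0 f -> smooth_near0 g -> smooth_near0 (f \* g).
Proof.
move=> /smooth_near0P[U U0 fU] /smooth_near0P[V V0 gV]; apply/smooth_near0P.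
exists (U `&` V); first exact: open_nbhsI.
move=> n; apply: Cn_onM; first by apply: openI; [case: U0|case: V0].
  by apply: sub_Cn_on (fU n); exact: subIsetl.
by apply: sub_Cn_on (gV n); exact: subIsetr.
Qed.

(** Functions equal near [x] are equal near every point close to [x], so their derivatives agree on
    a neighborhood; this permits iteration. *)
Lemma near_eq_derive1 (x : R) f g : {near x, f =1 g} ->
  {near x, derive1 f =1 derive1 g}.
Proof.
move=> /near_join; apply: filterS => t fg.
by rewrite !derive1E; exact: near_eq_derive.
Qed.

Lemma near_eq_derive1n n (x : R) f g : {near x, f =1 g} ->
  {near x, derive1n n f =1 derive1n n g}.
Proof. by move=> fg; elim: n => [//|n /near_eq_derive1]. Qed.

Lemma derive1n_near n f g : {near 0, f =1 g} -> derive1n n f 0 = derive1n n g 0.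
Proof. by move=> /(near_eq_derive1n n)/nbhs_singleton. Qed.

Lemma smooth_near0_derivable f : smooth_near0 f ->
  \forall t \near (0 : R), derivable f t 1.
Proof. by apply: filterS => t /(_ 0%N). Qed.

Lemma smooth_near0_continuous f : smooth_near0 f -> {for 0, continuous f}.
Proof.
move=> /smooth_near0_derivable/nbhs_singleton df.
exact/differentiable_continuous/derivable1_diffP.
Qed.

Lemma smooth_near0_cvg0 f : f 0 = 0 -> smooth_near0 f -> f t @[t --> 0] --> 0.
Proof.
by move=> f0 /smooth_near0_continuous; rewrite /prop_for /continuous_at f0.
Qed.

Lemma smooth_near0_derive1 f : smooth_near0 f -> smooth_near0 (derive1 f).
Proof. by apply: filterS => t df j; rewrite -derive1nSr. Qed.

Lemma smooth_near0_neq0 f : smooth_near0 f -> f 0 != 0 ->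
  \forall t \near (0 : R), f t != 0.
Proof.
by move=> /smooth_near0_continuous cf f0; exact: cvgr_neq0 cf f0.
Qed.

Lemma smooth_near0V f : f 0 != 0 -> smooth_near0 f ->
  smooth_near0 (fun t => (f t)^-1).
Proof.
move=> f0 sf; have [V V0 fV] := near0_open_nbhs (smooth_near0_neq0 sf f0).
have /smooth_near0P[U U0 fU] := sf; apply/smooth_near0P.
exists (U `&` V); first exact: open_nbhsI.
move=> n; apply: Cn_onV; first by apply: openI; [case: U0|case: V0].
  by move=> t [_ /fV].
by apply: sub_Cn_on (fU n); exact: subIsetl.
Qed.

(** [f] is controlled only near 0; as [g] fixes 0, continuity keeps the values of [g] where [f] is
    smooth. *)
Lemma smooth_near0_comp f g : g 0 = 0 -> smooth_near0 f -> smooth_near0 g ->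
  smooth_near0 (f \o g).
Proof.
move=> g0 /smooth_near0P[V [oV V0] fV] sg.
have : \forall t \near (0 : R), V (g t).
  by apply: (smooth_near0_continuous sg); rewrite g0; exact: open_nbhs_nbhs.
move=> /near0_open_nbhs[W W0 gW].
have /smooth_near0P[U U0 gU] := sg; apply/smooth_near0P.
exists (U `&` W); first exact: open_nbhsI.
move=> n; apply: (@Cn_on_comp _ _ V); first by apply: openI; [case: U0|case: W0].
- by move=> t [_ /gW].
- exact: fV.
- by apply: sub_Cn_on (gU n); exact: subIsetl.
Qed.

End SmoothNear0.

(** * Families whose derivatives at 0 converge *)

Section DerivsCvg.
Context {R : realType} {T : Type} (G : set_system T) {FG : Filter G}.
Implicit Types (u v : T -> R -> R) (f g : R -> R) (n : nat).

(* With a constant family [u], this says that [u] and [f] have the same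
   derivatives of order at most [n] at 0. *)
Definition derivs_cvg n u f := forall j, (j <= n)%N ->
  (fun e => derive1n j (u e) 0) @ G --> derive1n j f 0.

(** Detaching the value at 0 leaves the same statement, one order lower, for the derivatives; the
    rules below proceed by induction along this splitting. *)
Lemma derivs_cvgS n u f : derivs_cvg n.+1 u f <->
  (fun e => u e 0) @ G --> f 0 /\
  derivs_cvg n (fun e => derive1 (u e)) (derive1 f).
Proof.
split=> [H|[H0 H] [//|j] jn].
  split=> [|j jn]; first exact: (H 0%N).
  have := H j.+1 jn; rewrite derive1nSr.
  by under eq_fun do rewrite derive1nSr.
rewrite derive1nSr; under eq_fun do rewrite derive1nSr.
exact: H.
Qed.

Lemma derivs_cvgW n m u f : (m <= n)%N -> derivs_cvg n u f ->
  derivs_cvg m u f.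
Proof. by move=> mn H j jm; apply: H; exact: leq_trans mn. Qed.

(** Lets a differentiation rule valid only near 0 replace the derivative; the neighborhood of 0 may
    depend on [e]. *)
Lemma near_derivs_cvg n u v f g : (\forall e \near G, {near 0, u e =1 v e}) ->
  {near 0, f =1 g} -> derivs_cvg n u f -> derivs_cvg n v g.
Proof.
move=> uv fg H j jn; rewrite -(derive1n_near j fg).
apply: cvg_trans (H j jn); apply: near_eq_cvg.
by apply: filterS uv => e /(derive1n_near j).
Qed.

Lemma derivs_cvgD n u v f g :
  (\forall e \near G, smooth_near0 (u e)) -> smooth_near0 f ->
  (\forall e \near G, smooth_near0 (v e)) -> smooth_near0 g ->
  derivs_cvg n u f -> derivs_cvg n v g ->
  derivs_cvg n (fun e => u e \+ v e) (f \+ g).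
Proof.
elim: n u v f g => [|n IHn] u v f g su sf sv sg.
  move=> cu cv [_|//]; apply: cvgD; [exact: (cu 0%N)|exact: (cv 0%N)].
move=> /derivs_cvgS[cu cu'] /derivs_cvgS[cv cv']; apply/derivs_cvgS; split.
  exact: cvgD.
have su' : \forall e \near G, smooth_near0 (derive1 (u e)).
  by apply: filterS su => e; exact: smooth_near0_derive1.
have sv' : \forall e \near G, smooth_near0 (derive1 (v e)).
  by apply: filterS sv => e; exact: smooth_near0_derive1.
have sf' := smooth_near0_derive1 sf; have sg' := smooth_near0_derive1 sg.
apply: (near_derivs_cvg
    (u := fun e => derive1 (u e) \+ derive1 (v e)) (f := derive1 f \+ derive1 g)).
- apply: filterS2 su sv => e /smooth_near0_derivable su /smooth_near0_derivable.
  by apply: filterS2 su => t du dv; rewrite derive1D.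
- move: (smooth_near0_derivable sf) (smooth_near0_derivable sg).
  by apply: filterS2 => t df dg; rewrite derive1D.
- exact: IHn su' sf' sv' sg' cu' cv'.
Qed.

(** In (uv)' = u'v + uv' the undifferentiated factors are needed only to order [n], so their
    hypotheses at order [n.+1] are weakened. *)
Lemma derivs_cvgM n u v f g :
  (\forall e \near G, smooth_near0 (u e)) -> smooth_near0 f ->
  (\forall e \near G, smooth_near0 (v e)) -> smooth_near0 g ->
  derivs_cvg n u f -> derivs_cvg n v g ->
  derivs_cvg n (fun e => u e \* v e) (f \* g).
Proof.
elim: n u v f g => [|n IHn] u v f g su sf sv sg.
  move=> cu cv [_|//]; apply: cvgM; [exact: (cu 0%N)|exact: (cv 0%N)].
move=> Cu Cv; have /derivs_cvgS[cu cu'] := Cu; have /derivs_cvgS[cv cv'] := Cv.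
apply/derivs_cvgS; split; first exact: cvgM.
have su' : \forall e \near G, smooth_near0 (derive1 (u e)).
  by apply: filterS su => e; exact: smooth_near0_derive1.
have sv' : \forall e \near G, smooth_near0 (derive1 (v e)).
  by apply: filterS sv => e; exact: smooth_near0_derive1.
have sf' := smooth_near0_derive1 sf; have sg' := smooth_near0_derive1 sg.
apply: (near_derivs_cvg
    (u := fun e => (derive1 (u e) \* v e) \+ (u e \* derive1 (v e)))
    (f := (derive1 f \* g) \+ (f \* derive1 g))).
- apply: filterS2 su sv => e /smooth_near0_derivable su /smooth_near0_derivable.
  by apply: filterS2 su => t du dv; rewrite derive1M.
- move: (smooth_near0_derivable sf) (smooth_near0_derivable sg).
  by apply: filterS2 => t df dg; rewrite derive1M.
- apply: derivs_cvgD.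
  + by apply: filterS2 su' sv => e; exact: smooth_near0M.
  + exact: smooth_near0M.
  + by apply: filterS2 su sv' => e; exact: smooth_near0M.
  + exact: smooth_near0M.
  + exact: IHn su' sf' sv sg cu' (derivs_cvgW (leqnSn n) Cv).
  + exact: IHn su sf sv' sg' (derivs_cvgW (leqnSn n) Cu) cv'.
Qed.

Lemma derivs_cvg_cst n f : derivs_cvg n (fun=> f) f.
Proof. by move=> j _; exact: cvg_cst. Qed.

Lemma derivs_cvgV n u f : f 0 != 0 ->
  (\forall e \near G, smooth_near0 (u e) /\ u e 0 != 0) -> smooth_near0 f ->
  derivs_cvg n u f -> derivs_cvg n (fun e t => (u e t)^-1) (fun t => (f t)^-1).
Proof.
move=> f0 su sf; elim: n => [|n IHn] Cu.
  by move=> [_|//]; apply: cvgV => //; exact: (Cu 0%N).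
have /derivs_cvgS[cu cu'] := Cu; apply/derivs_cvgS; split; first exact: cvgV.
have {}IHn := IHn (derivs_cvgW (leqnSn _) Cu).
have Hd (h : R -> R) : smooth_near0 h -> h 0 != 0 ->
    {near 0, (cst (-1) \* derive1 h) \* ((fun t => (h t)^-1) \* (fun t => (h t)^-1))
       =1 derive1 (fun t => (h t)^-1)}.
  move=> sh h0; move: (smooth_near0_derivable sh) (smooth_near0_neq0 sh h0).
  by apply: filterS2 => t dh nh; rewrite derive1V //= mulN1r.
apply: near_derivs_cvg (Hd _ sf f0) _.
  apply: filterS su => e [se e0]; exact: Hd se e0.
have sV : smooth_near0 (fun t => (f t)^-1) by exact: smooth_near0V.
have sVu : \forall e \near G, smooth_near0 (fun t => (u e t)^-1).
  by apply: filterS su => e [? ?]; exact: smooth_near0V.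
have sf' := smooth_near0_derive1 sf.
have su' : \forall e \near G, smooth_near0 (derive1 (u e)).
  by apply: filterS su => e [? _]; exact: smooth_near0_derive1.
have sc := smooth_near0_cst (-1 : R).
apply: derivs_cvgM.
- by apply: filterS su' => e; exact: smooth_near0M.
- exact: smooth_near0M.
- by apply: filterS sVu => e ?; exact: smooth_near0M.
- exact: smooth_near0M.
- apply: (derivs_cvgM _ sc su' sf' _ cu'); first exact: filterE.
  exact: derivs_cvg_cst.
- exact: (derivs_cvgM sVu sV sVu sV IHn IHn).
Qed.

(** By the chain rule the derivative is a composite with the family of derivatives, covered by
    induction, times the fixed factor phi'. *)
Lemma derivs_cvg_comp n u f (phi : R -> R) : phi 0 = 0 -> smooth_near0 phi ->
  (\forall e \near G, smooth_near0 (u e)) -> smooth_near0 f ->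
  derivs_cvg n u f -> derivs_cvg n (fun e => u e \o phi) (f \o phi).
Proof.
move=> p0 sp; elim: n u f => [|n IHn] u f su sf.
  by move=> cu [_|//]; rewrite /derive1n /= p0; exact: (cu 0%N).
move=> /derivs_cvgS[cu cu']; apply/derivs_cvgS; split; first by rewrite /= p0.
have Hd (h : R -> R) : smooth_near0 h ->
    {near 0, (derive1 h \o phi) \* derive1 phi =1 derive1 (h \o phi)}.
  move=> /smooth_near0_derivable sh.
  have cp := smooth_near0_cvg0 p0 sp.
  apply: filterS2 (smooth_near0_derivable sp) (cp _ sh) => t dp dh.
  by symmetry; exact: (@derive1_comp R phi h t dp dh).
apply: near_derivs_cvg (Hd _ sf) _.
  by apply: filterS su => e; exact: Hd.
have sf' := smooth_near0_derive1 sf.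
have su' : \forall e \near G, smooth_near0 (derive1 (u e)).
  by apply: filterS su => e; exact: smooth_near0_derive1.
have sp' := smooth_near0_derive1 sp.
apply: derivs_cvgM.
- by apply: filterS su' => e se; exact: (smooth_near0_comp p0 se sp).
- exact: (smooth_near0_comp p0 sf' sp).
- exact: filterE.
- exact: sp'.
- exact: IHn su' sf' cu'.
- exact: derivs_cvg_cst.
Qed.

End DerivsCvg.

(** * Jets and prolongations of rational maps *)

Section Contact.
Context {R : realType} {n : nat}.
Implicit Types (g d h : R -> 'cV[R]_n) (phi : R -> R) (k : nat).

(** A constant family converges only to its own value, limits along a proper filter being unique.
    Convergence results thus specialize to equalities of Taylor data; the filter at 0 is an
    arbitrary choice. *)
Lemma derivs_cvg_eqP k (a b : R -> R) :
  derivs_cvg (nbhs (0 : R)) k (fun=> a) b <->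
  forall j, (j <= k)%N -> derive1n j a 0 = derive1n j b 0.
Proof.
split=> H j jk; last by rewrite -(H j jk); exact: cvg_cst.
by apply: cvg_unique (H j jk); [exact: norm_hausdorff|exact: cvg_cst].
Qed.

Lemma taylor_eqP k g d : taylor k g = taylor k d <->
  forall i, derivs_cvg (nbhs (0 : R)) k (fun=> coord g i) (coord d i).
Proof.
split=> [/matrixP H i|H].
  apply/derivs_cvg_eqP => j jk.
  by have := H (Ordinal (jk : (j < k.+1)%N)) i; rewrite !mxE.
apply/matrixP => j i; rewrite !mxE; move/derivs_cvg_eqP: (H i); apply.
by rewrite -ltnS.
Qed.

Lemma taylor_near k g d : {near 0, g =1 d} -> taylor k g = taylor k d.
Proof.
move=> gd; apply/matrixP => j i; rewrite !mxE; apply: derive1n_near.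
by apply: filterS gd => t; rewrite /coord => ->.
Qed.

Lemma taylor_eq0 k g d : taylor k g = taylor k d -> g 0 = d 0.
Proof.
move=> /matrixP H; apply/matrixP => i j.
by have := H ord0 i; rewrite !mxE /= /coord ord1.
Qed.

Lemma diffeo_germ_id : diffeo_germ (@id R).
Proof.
exists id; split=> //; try exact: smooth_near0_id; exact: filterE.
Qed.

Lemma diffeo_germ_comp phi phi' : diffeo_germ phi -> diffeo_germ phi' ->
  diffeo_germ (phi \o phi').
Proof.
move=> [psi [[p0 q0] sp sq qp pq]] [psi' [[p0' q0'] sp' sq' qp' pq']].
exists (psi' \o psi); split.
- by rewrite /= p0' p0 q0 q0'.
- exact: (smooth_near0_comp p0' sp sp').
- exact: (smooth_near0_comp q0 sq' sq).
- have := smooth_near0_cvg0 p0' sp' qp.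
  by apply: filterS2 qp' => t /= e1 e2; rewrite e2 e1.
- have := smooth_near0_cvg0 q0 sq pq'.
  by apply: filterS2 pq => t /= e1 e2; rewrite e2 e1.
Qed.

(** Differentiating [psi \o phi = id] at 0 gives psi'(0) phi'(0) = 1. *)
Lemma diffeo_germ_derive1_neq0 phi : diffeo_germ phi -> derive1 phi 0 != 0.
Proof.
move=> [psi [[p0 q0] sp sq qp _]]; apply/eqP => dp0.
have dp := nbhs_singleton (smooth_near0_derivable sp).
have dq : derivable psi (phi 0) 1.
  by rewrite p0; exact: nbhs_singleton (smooth_near0_derivable sq).
have : derive1 (psi \o phi) 0 = derive1 (@id R) 0.
  exact: nbhs_singleton (near_eq_derive1 qp).
rewrite (derive1_compR dp dq) dp0 mulr0 derive1E derive_id.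
by move/esym/eqP; rewrite oner_eq0.
Qed.

Lemma smooth_curve_comp g phi : phi 0 = 0 -> smooth_near0 phi ->
  smooth_curve g -> smooth_curve (g \o phi).
Proof. by move=> p0 sp sg i; exact: (smooth_near0_comp p0 (sg i) sp). Qed.

Lemma velocity_comp g phi : phi 0 = 0 -> smooth_near0 phi -> smooth_curve g ->
  velocity (g \o phi) = derive1 phi 0 *: velocity g.
Proof.
move=> p0 sp sg; apply/matrixP => i j; rewrite !mxE mulrC.
have dp := nbhs_singleton (smooth_near0_derivable sp).
have dg : derivable (coord g i) (phi 0) 1.
  by rewrite p0; exact: nbhs_singleton (smooth_near0_derivable (sg i)).
have H := derive1_compR dp dg; rewrite p0 in H; exact: H.
Qed.

Lemma taylor_comp k g d phi : phi 0 = 0 -> smooth_near0 phi ->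
  smooth_curve g -> smooth_curve d -> taylor k g = taylor k d ->
  taylor k (g \o phi) = taylor k (d \o phi).
Proof.
move=> p0 sp sg sd /taylor_eqP H; apply/taylor_eqP => i.
have si := @filterE R (nbhs 0) (nbhs_filter 0)
  (fun=> smooth_near0 (coord g i)) (fun=> sg i).
have Hc := derivs_cvg_comp (u := fun=> coord g i) p0 sp si (sd i) (H i).
exact: Hc.
Qed.

Lemma contact_refl k g : contact k g g.
Proof. by exists id; first exact: diffeo_germ_id. Qed.

Lemma contact_trans k g d h :
  smooth_curve g -> smooth_curve d ->
  contact k g d -> contact k d h -> contact k g h.
Proof.
move=> sg sd [phi dp gd] [phi' dp' dh].
exists (phi \o phi'); first exact: diffeo_germ_comp.
have [_ [[p0 _] sp _ _ _]] := dp; have [_ [[p0' _] sp' _ _ _]] := dp'.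
have sgp := smooth_curve_comp p0 sp sg.
exact: etrans (taylor_comp p0' sp' sgp sd gd) dh.
Qed.

(** Reparametrizing both sides by the inverse germ [psi] turns [g \o phi] into a curve equal to [g]
    near 0. *)
Lemma contact_sym k g d :
  smooth_curve g -> smooth_curve d -> contact k g d -> contact k d g.
Proof.
move=> sg sd [phi [psi [[p0 q0] sp sq qp pq]] gd].
exists psi; first by exists phi; split.
transitivity (taylor k (g \o phi \o psi)).
  have sgp := smooth_curve_comp p0 sp sg.
  exact: esym (taylor_comp q0 sq sgp sd gd).
by apply: taylor_near; apply: filterS pq => t /= ->.
Qed.

Lemma contact_at0 k g d : contact k g d -> d 0 = g 0.
Proof.
by move=> [phi [_ [[p0 _] _ _ _ _]] /taylor_eq0 /= <-]; rewrite p0.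
Qed.

Lemma jet_eq k g d : smooth_curve g -> smooth_curve d -> contact k g d ->
  jet k g = jet k d.
Proof.
move=> sg sd gd; apply/seteqP; split=> h [rh].
  by split=> //; apply: contact_trans (contact_sym sg sd gd) _.
by split=> //; apply: contact_trans gd _.
Qed.

Lemma jet_contact k g d : regular_curve d -> jet k g = jet k d ->
  contact k g d.
Proof.
by move=> rd /seteqP[_ /(_ d)]; case=> //; split=> //; exact: contact_refl.
Qed.

End Contact.

(** * Rational functions and maps along curves *)

Section Rational.
Context {R : realType} {m : nat}.
Implicit Types (p : 'cV[R]_m) (f : 'cV[R]_m -> R) (g : R -> 'cV[R]_m).

(** Denominators are required to be nonzero at [p] only. The constructors match the rules for sums,
    products and inverses, so these rules extend to rational functions by induction. *)
Inductive rational_at p : ('cV[R]_m -> R) -> Prop :=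
| rational_cst a : rational_at p (fun=> a)
| rational_coord i : rational_at p (fun q => q i 0)
| rationalD f1 f2 : rational_at p f1 -> rational_at p f2 ->
    rational_at p (fun q => f1 q + f2 q)
| rationalM f1 f2 : rational_at p f1 -> rational_at p f2 ->
    rational_at p (fun q => f1 q * f2 q)
| rationalV f : f p != 0 -> rational_at p f -> rational_at p (fun q => (f q)^-1).

Lemma smooth_rational f g : smooth_curve g -> rational_at (g 0) f ->
  smooth_near0 (f \o g).
Proof.
move=> sg; elim=> [a|i|f1 f2 _ s1 _ s2|f1 f2 _ s1 _ s2|f1 f0 _ s1].
- exact: smooth_near0_cst.
- exact: sg.
- exact: smooth_near0D s1 s2.
- exact: smooth_near0M s1 s2.
- exact: (smooth_near0V (f := f1 \o g) f0 s1).
Qed.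

(** Smoothness and convergence are proved together because the rules for convergence ask for
    both. *)
Lemma derivs_cvg_rational {T : Type} (G : set_system T) {FG : Filter G} k
    (u : T -> R -> 'cV[R]_m) g f :
  (forall e, smooth_curve (u e)) -> smooth_curve g -> rational_at (g 0) f ->
  (forall i, derivs_cvg G k (fun e => coord (u e) i) (coord g i)) ->
  (\forall e \near G, smooth_near0 (f \o u e)) /\
  derivs_cvg G k (fun e => f \o u e) (f \o g).
Proof.
move=> su sg rf cu.
elim: rf => [a|i|f1 f2 r1 [s1 c1] r2 [s2 c2]|f1 f2 r1 [s1 c1] r2 [s2 c2]|].
- split; first by apply: filterE => e; exact: smooth_near0_cst.
  exact: derivs_cvg_cst.
- by split; [apply: filterE => e; exact: su|exact: cu].
- have t1 := smooth_rational sg r1; have t2 := smooth_rational sg r2.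
  split; first by apply: filterS2 s1 s2 => e; exact: smooth_near0D.
  exact: (derivs_cvgD s1 t1 s2 t2 c1 c2).
- have t1 := smooth_rational sg r1; have t2 := smooth_rational sg r2.
  split; first by apply: filterS2 s1 s2 => e; exact: smooth_near0M.
  exact: (derivs_cvgM s1 t1 s2 t2 c1 c2).
- move=> f1 f0 r1 [s1 c1]; have t1 := smooth_rational sg r1.
  (* Convergence of the values at 0 keeps the denominator nonzero eventually along [G]. *)
  have n0 : \forall e \near G, f1 (u e 0) != 0.
    exact: (cvgr_neq0 _ (c1 0%N isT) f0).
  have sn : \forall e \near G, smooth_near0 (f1 \o u e) /\ (f1 \o u e) 0 != 0.
    by apply: filterS2 s1 n0 => e.
  split; last exact: (derivs_cvgV (f := f1 \o g) f0 sn t1 c1).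
  by apply: filterS sn => e [? ?]; exact: (smooth_near0V (f := f1 \o u e)).
Qed.

End Rational.

Section RationalMap.
Context {R : realType} {m n : nat}.
Implicit Types (p : 'cV[R]_m) (F : 'cV[R]_m -> 'cV[R]_n) (g d : R -> 'cV[R]_m).

Definition rational_map_at p F : Prop :=
  forall i, rational_at p (fun q => F q i 0).

Lemma smooth_curve_rational F g : rational_map_at (g 0) F ->
  smooth_curve g -> smooth_curve (F \o g).
Proof. by move=> rF sg i; exact: (smooth_rational sg (rF i)). Qed.

Lemma taylor_rational k F g d : rational_map_at (d 0) F ->
  smooth_curve g -> smooth_curve d -> taylor k g = taylor k d ->
  taylor k (F \o g) = taylor k (F \o d).
Proof.
move=> rF sg sd /taylor_eqP H; apply/taylor_eqP => i.
have sg' : R -> smooth_curve g by [].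
exact: (derivs_cvg_rational sg' sd (rF i) H).2.
Qed.

Lemma contact_rational k F g d : rational_map_at (g 0) F ->
  smooth_curve g -> smooth_curve d -> contact k g d ->
  contact k (F \o g) (F \o d).
Proof.
move=> rF sg sd gd; have d0 := contact_at0 gd; have [phi dp H] := gd.
have [_ [[p0 _] sp _ _ _]] := dp; exists phi => //.
rewrite -d0 in rF.
exact: (taylor_rational rF (smooth_curve_comp p0 sp sg) sd H).
Qed.

(** The choice made by [prolong] is forced: any other representative of the jet has contact with
    [g], and a map rational at the base point preserves contact. *)
Lemma prolong_jet k (P : set (R -> 'cV[R]_m)) F g : regular_curve g -> P g ->
  rational_map_at (g 0) F -> prolong k P F (jet k g) = jet k (F \o g).
Proof.
move=> rg Pg rF; have Hg : prolongs k P F (jet k g) (jet k (F \o g)).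
  by exists g.
rewrite /prolong; apply: xget_unique => // w [d [rd Pd gd ->]].
have cgd := jet_contact rd gd; symmetry; apply: jet_eq.
- exact: smooth_curve_rational rF rg.1.
- apply: smooth_curve_rational rd.1; rewrite (contact_at0 cgd); exact: rF.
- exact: contact_rational rF rg.1 rd.1 cgd.
Qed.

End RationalMap.

(** * The central projection *)

Section CentralProjection.
Context {R : realType}.
Implicit Types (c p v : 'cV[R]_3) (A : 'M[R]_3).

Lemma ord3_ind (P : 'I_3 -> Prop) : P 0 -> P 1 -> P 2 -> forall i, P i.
Proof.
move=> P0 P1 P2 [[|[|[|//]]] Hi].
- by rewrite (_ : Ordinal Hi = 0) //; exact: val_inj.
- by rewrite (_ : Ordinal Hi = 1) //; exact: val_inj.
- by rewrite (_ : Ordinal Hi = 2) //; exact: val_inj.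
Qed.

Lemma sum_ord3 (F : 'I_3 -> R) : \sum_(i < 3) F i = F 0 + F 1 + F 2.
Proof.
rewrite !big_ord_recl big_ord0 addr0 addrA; congr (F _ + F _ + F _);
  exact: val_inj.
Qed.

Lemma eq_rational_at n (p : 'cV[R]_n) f g : f =1 g -> rational_at p f ->
  rational_at p g.
Proof. by move=> /funext ->. Qed.

Lemma rational_shift n (p : 'cV[R]_n) i a : rational_at p (fun q => q i 0 + a).
Proof. by apply: rationalD; [exact: rational_coord|exact: rational_cst]. Qed.

Lemma rational_mulc n (p : 'cV[R]_n) i a : rational_at p (fun q => a * q i 0).
Proof. by apply: rationalM; [exact: rational_cst|exact: rational_coord]. Qed.

Lemma central_proj_rational c p : offplane c p ->
  rational_map_at p (central_proj c).
Proof.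
rewrite /offplane /= -subr_eq0 => pc i.
have H j : rational_at p (fun q => (q j 0 - c j 0) / (q 2 0 - c 2 0) + c j 0).
  apply: rationalD; last exact: rational_cst.
  apply: rationalM; first exact: rational_shift.
  by apply: rationalV => //; exact: rational_shift.
have [i0|i0] := eqVneq i 0.
  by apply: eq_rational_at (H 0) => q; rewrite mxE i0.
by apply: eq_rational_at (H 1) => q; rewrite mxE (negbTE i0).
Qed.

Lemma linfrac_rational A (p : 'cV[R]_2) : linfrac_den A p != 0 ->
  rational_map_at p (linfrac A).
Proof.
move=> pA i.
have H a b d :
    rational_at p (fun q => (a * q 0 0 + b * q 1 0 + d) / linfrac_den A q).
  have L a' b' d' : rational_at p (fun q => a' * q 0 0 + b' * q 1 0 + d').
    apply: rationalD; last exact: rational_cst.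
    by apply: rationalD; exact: rational_mulc.
  by apply: rationalM; [|apply: rationalV]; [exact: L|exact: pA|exact: L].
have [i0|i0] := eqVneq i 0.
  by apply: eq_rational_at (H (A 0 0) (A 0 1) (A 0 2)) => q; rewrite mxE i0.
apply: eq_rational_at (H (A 1 0) (A 1 1) (A 1 2)) => q.
by rewrite mxE (negbTE i0).
Qed.

Lemma Ad_translation_rational c A p : rational_map_at p (Ad_translation c A).
Proof.
move=> i.
have H j : rational_at p (fun q => A i j * (q j 0 - c j 0)).
  by apply: rationalM; [exact: rational_cst|exact: rational_shift].
apply: (@eq_rational_at _ _ (fun q => A i 0 * (q 0 0 - c 0 0) +
    A i 1 * (q 1 0 - c 1 0) + A i 2 * (q 2 0 - c 2 0) + c i 0)) => [q|].
  by rewrite /Ad_translation /translation /= !mxE sum_ord3 !mxE.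
apply: rationalD; last exact: rational_cst.
by apply: rationalD => //; apply: rationalD.
Qed.

(** * Homogeneous coordinates and the intertwining of the two actions *)

Definition hom_coord (p : 'cV[R]_2) : 'cV[R]_3 :=
  \col_i (if i == 0 then p 0 0 else if i == 1 then p 1 0 else 1).

Lemma linfrac_denE A (p : 'cV[R]_2) :
  linfrac_den A p = (A *m hom_coord p) 2 0.
Proof. by rewrite mxE sum_ord3 !mxE /= mulr1. Qed.

Lemma linfracE A (p : 'cV[R]_2) :
  linfrac A p = \col_i ((A *m hom_coord p) (if i == 0 then 0 else 1) 0 /
                        (A *m hom_coord p) 2 0).
Proof.
apply/matrixP => i j; rewrite [LHS]mxE [RHS]mxE -linfrac_denE.
by rewrite mxE sum_ord3 !mxE /= mulr1; case: ifP.
Qed.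

(** In homogeneous coordinates this is the translation of the plane by the first two coordinates of
    [c]; it accounts for the summands [c 0 0] and [c 1 0] of the central projection. *)
Definition shear c : 'M[R]_3 :=
  \matrix_(i, j) ((i == j)%:R + ((i != 2) && (j == 2))%:R * c i 0).

Lemma shearE c v i :
  (shear c *m v) i 0 = v i 0 + (i != 2)%:R * c i 0 * v 2 0.
Proof.
rewrite mxE sum_ord3 !mxE /=.
by elim/ord3_ind: i => /=; ring.
Qed.

Lemma shear_unit c : shear c \in unitmx.
Proof.
have H : shear c *m shear (- c) = 1%:M.
  apply/matrixP => i j; rewrite mxE sum_ord3 !mxE.
  by elim/ord3_ind: i; elim/ord3_ind: j => /=; ring.
by have [] := mulmx1_unit H.
Qed.

Lemma hom_central_proj c p : offplane c p ->
  hom_coord (central_proj c p) = (p 2 0 - c 2 0)^-1 *: (shear c *m (p - c)).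
Proof.
rewrite /offplane /= -subr_eq0 => pc; apply/matrixP => i j.
rewrite (ord1 j) [LHS]mxE [RHS]mxE shearE !mxE.
by elim/ord3_ind: i => /=; field.
Qed.

Lemma central_projE c v : central_proj c (v + c) =
  \col_i (v (if i == 0 then 0 else 1) 0 / v 2 0 + c (if i == 0 then 0 else 1) 0).
Proof.
by apply/matrixP => i j; rewrite !mxE !addrK; case: ifP.
Qed.

(** [B] sends [shear c *m (p - c)] to [shear c *m (A *m (p - c))], and the common scalar factor
    cancels in the quotients. *)
Lemma linfrac_central_proj c A p (B := shear c *m A *m invmx (shear c)) :
  offplane c p -> offplane c (Ad_translation c A p) ->
  linfrac_den B (central_proj c p) != 0 /\
  linfrac B (central_proj c p) = central_proj c (Ad_translation c A p).
Proof.
move=> pc qc; have s0 : p 2 0 - c 2 0 != 0 by rewrite subr_eq0.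
have HB : B *m hom_coord (central_proj c p) =
    (p 2 0 - c 2 0)^-1 *: (shear c *m (A *m (p - c))).
  rewrite hom_central_proj // -scalemxAr /B !mulmxA mulmxKV ?shear_unit //.
(* This is exactly the condition that the image of [p] is off the plane; it makes the denominator of
   [linfrac B] nonzero. *)
have v0 : (A *m (p - c)) 2 0 != 0.
  by move: qc; rewrite /offplane /Ad_translation /translation /= mxE
    -subr_eq0 addrK.
rewrite linfrac_denE linfracE HB /Ad_translation /translation /= central_projE.
set v := A *m (p - c) in v0 *.
have d0 : ((p 2 0 - c 2 0)^-1 *: (shear c *m v)) 2 0 = v 2 0 / (p 2 0 - c 2 0).
  by rewrite mxE shearE /=; ring.
rewrite d0; split; first by rewrite mulf_neq0 // invr_eq0.
apply/matrixP => i j; rewrite mxE [RHS]mxE mxE shearE.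
by case: ifP => _ /=; field; rewrite s0 v0.
Qed.

(** * Transversality to the fibers *)

Lemma offplane_near c (g : R -> 'cV[R]_3) : smooth_curve g -> offplane c (g 0) ->
  \forall t \near (0 : R), offplane c (g t).
Proof.
move=> sg; rewrite /offplane /= => g0; rewrite -subr_eq0 in g0.
have sz : smooth_near0 (fun t => g t 2 0 - c 2 0).
  exact: (smooth_near0D (sg 2) (smooth_near0_cst (- c 2 0))).
by apply: filterS (smooth_near0_neq0 sz g0) => t; rewrite subr_eq0.
Qed.

(** Recovers the velocity from the projected one. When the latter vanishes, the velocity is a
    multiple of [g 0 - c], the direction of the fiber. *)
Lemma velocity_central_proj c (g : R -> 'cV[R]_3) (i : 'I_2) (i' : 'I_3) :
  smooth_curve g -> offplane c (g 0) -> i' = (if i == 0 then 0 else 1) ->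
  velocity g i' 0 =
    velocity (central_proj c \o g) i 0 * (g 0 2 0 - c 2 0) +
    (g 0 i' 0 - c i' 0) / (g 0 2 0 - c 2 0) * velocity g 2 0.
Proof.
move=> sg g0 ii'.
have sw := smooth_curve_rational (central_proj_rational g0) sg.
set w := coord (central_proj c \o g) i.
have wE t : w t = (g t i' 0 - c i' 0) / (g t 2 0 - c 2 0) + c i' 0.
  by rewrite /w /coord /= mxE ii'; case: ifP.
(* Solving the projection formula for [coord g i'] leaves only sums and a product to differentiate,
   with no quotient. *)
have gE : {near 0, ((w \+ cst (- c i' 0)) \* (coord g 2 \+ cst (- c 2 0)))
    \+ cst (c i' 0) =1 coord g i'}.
  apply: filterS (offplane_near sg g0) => t; rewrite /offplane /= -subr_eq0 => t0.
  by rewrite wE /coord; field.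
have dz := nbhs_singleton (smooth_near0_derivable (sg 2)).
have dw := nbhs_singleton (smooth_near0_derivable (sw i)).
have dc a : derivable (cst (a : R)) (0 : R) 1 by exact: derivable_cst.
have dw' := derivableD dw (dc (- c i' 0)).
have dz' := derivableD dz (dc (- c 2 0)).
rewrite !mxE -(nbhs_singleton (near_eq_derive1 gE)).
rewrite (derive1D (derivableM dw' dz') (dc _)) (derive1M dw' dz').
rewrite (derive1D dw (dc _)) (derive1D dz (dc _)) !derive1_cst !addr0.
by have <- : w 0 - c i' 0 = (g 0 i' 0 - c i' 0) / (g 0 2 0 - c 2 0)
  by rewrite wE addrK.
Qed.

Lemma smooth_line n (p v : 'cV[R]_n) : smooth_curve (fun t : R => p + t *: v).
Proof.
move=> i; rewrite (_ : coord _ i = (cst (p i 0) \+ (@id R \* cst (v i 0)))).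
  apply: smooth_near0D; first exact: smooth_near0_cst.
  by apply: smooth_near0M; [exact: smooth_near0_id|exact: smooth_near0_cst].
by apply/funext => t; rewrite /coord /= !mxE.
Qed.

Lemma velocity_line n (p v : 'cV[R]_n) : velocity (fun t : R => p + t *: v) = v.
Proof.
apply/matrixP => i j; rewrite (ord1 j) mxE.
rewrite (_ : coord _ i = (cst (p i 0) \+ (@id R \* cst (v i 0)))); last first.
  by apply/funext => t; rewrite /coord /= !mxE.
have dc a : derivable (cst (a : R)) (0 : R) 1 by exact: derivable_cst.
have di : derivable (@id R) 0 1 by exact: derivable_id.
have dm : derivable (@id R \* cst (v i 0)) 0 1.
  exact: (@derivableM R R id (cst (v i 0)) 0 1 di (dc _)).
rewrite (derive1D (dc _) dm) (derive1M di (dc _)) !derive1_cst.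
by rewrite [X in X * _]derive1E derive_id /= mul0r addr0 add0r mul1r.
Qed.

Lemma velocity_taylor n k (g d : R -> 'cV[R]_n) : (0 < k)%N ->
  taylor k g = taylor k d -> velocity g = velocity d.
Proof.
move=> k0 /taylor_eqP H; apply/matrixP => i j; rewrite !mxE.
by move/derivs_cvg_eqP: (H i) => /(_ 1%N k0).
Qed.

Lemma velocity_cst n (p : 'cV[R]_n) : velocity (fun=> p : 'cV[R]_n) = 0.
Proof. by apply/matrixP => i j; rewrite !mxE derive1_cst. Qed.

(** The fibers are pieces of lines through [c], and their directions are the kernel of the
    differential of the projection. Transversality becomes a condition on first derivatives that is
    visibly open. *)
Lemma transversal_velocityP c (g : R -> 'cV[R]_3) : curve_in (offplane c) g ->
  transversal_in (offplane c) (central_proj c) g <->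
  velocity (central_proj c \o g) != 0.
Proof.
move=> cg; have [[sg _] /nbhs_singleton g0] := cg.
have s0 : g 0 2 0 - c 2 0 != 0 by rewrite subr_eq0.
split=> [[_ ntg]|vg].
  apply/eqP => vg0; apply: ntg; set p := g 0 in g0 s0 *; set v := velocity g.
  have vE i : v i 0 = v 2 0 / (p 2 0 - c 2 0) * (p i 0 - c i 0).
    elim/ord3_ind: i.
    - rewrite /v (velocity_central_proj (i := 0) sg g0) // vg0 !mxE.
      by rewrite -/p; field.
    - rewrite /v (velocity_central_proj (i := 1) sg g0) // vg0 !mxE.
      by rewrite -/p; field.
    - by field.
  pose l := v 2 0 / (p 2 0 - c 2 0).
  (* Since [v] is [l *: (p - c)], this line passes through [c] if extended; it stays in the fiber as
     long as [1 + t * l] is nonzero. *)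
  exists (fun t => p + t *: v); split.
  - exact: smooth_line.
  - by rewrite scale0r addr0.
  - exact: velocity_line.
  have sl : smooth_near0 (cst (1 : R) \+ (@id R \* cst l)).
    apply: smooth_near0D; first exact: smooth_near0_cst.
    by apply: smooth_near0M; [exact: smooth_near0_id|exact: smooth_near0_cst].
  have l0 : (cst (1 : R) \+ (@id R \* cst l)) 0 != 0.
    by rewrite /= mul0r addr0 oner_eq0.
  apply: filterS (smooth_near0_neq0 sl l0) => t /= tl.
  have addE (a b : 'cV[R]_3) s i : (a + s *: b) i 0 = a i 0 + s * b i 0.
    by rewrite !mxE.
  have dE i : (p + t *: v) i 0 - c i 0 = (1 + t * l) * (p i 0 - c i 0).
    by rewrite addE vE -/l; ring.
  have d2 : (p + t *: v) 2 0 - c 2 0 != 0 by rewrite dE mulf_neq0.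
  split; first by rewrite /offplane /= -subr_eq0.
  apply/matrixP => i j; rewrite mxE [RHS]mxE !dE.
  by case: ifP => _; field; rewrite s0.
split=> // -[d [sd d0 dv nd]]; move/eqP: vg; apply.
(* [d] lies in the fiber and agrees with [g] to first order, so the projected velocity of [g] is
   that of a constant curve. *)
have gd : taylor 1 g = taylor 1 d.
  apply/matrixP => -[[|[|//]] Hj] i; rewrite !mxE /=.
    by rewrite /coord d0.
  by move/matrixP: dv => /(_ i 0); rewrite !mxE.
have rd : rational_map_at (d 0) (central_proj c).
  by rewrite d0; exact: central_proj_rational.
rewrite (velocity_taylor (ltn0Sn 0) (taylor_rational rd sg sd gd)).
rewrite -[RHS](velocity_cst (central_proj c (g 0))).
apply: (velocity_taylor (ltn0Sn 0)); apply: taylor_near.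
by apply: filterS nd => t [_].
Qed.

End CentralProjection.

(** * Openness of the domain *)

Section Perturbation.
Context {R : realType}.

Lemma derive1nD m (f g : R -> R) : smooth_near0 f -> smooth_near0 g ->
  derive1n m (f \+ g) 0 = derive1n m f 0 + derive1n m g 0.
Proof.
elim: m f g => [//|m IHm] f g sf sg; rewrite !derive1nSr.
rewrite -(IHm _ _ (smooth_near0_derive1 sf) (smooth_near0_derive1 sg)).
apply: derive1n_near.
move: (smooth_near0_derivable sf) (smooth_near0_derivable sg).
by apply: filterS2 => t df dg; rewrite derive1D.
Qed.

Lemma derive1n_horner m (p : {poly R}) :
  derive1n m (horner p) = horner (derivn m p).
Proof.
elim: m p => [p|m IHm p]; first by rewrite derivn0.
by rewrite derive1nS IHm -derivE -derivnS.
Qed.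

Lemma smooth_near0_horner (p : {poly R}) : smooth_near0 (horner p).
Proof.
by apply: filterE => t j; rewrite derive1n_horner; exact: derivable_horner.
Qed.

Lemma cvg_mx {T : Type} (G : set_system T) {FG : Filter G} m n
    (M : T -> 'M[R]_(m, n)) (N : 'M[R]_(m, n)) :
  (forall i j, M e i j @[e --> G] --> N i j) -> M @ G --> N.
Proof.
move=> MN V [P NP PV].
have : \forall e \near G, forall i j, P i j (M e i j).
  by apply: filter_forall => i; apply: filter_forall => j; exact: MN.
by apply: filterS => e Pe; exact: PV.
Qed.

Context {n k : nat}.
Implicit Types (g : R -> 'cV[R]_n) (A E : 'M[R]_(k.+1, n)).

Definition perturb g A E : R -> 'cV[R]_n := fun t =>
  \col_i (g t i 0 + (\poly_(j < k.+1) ((E - A) (inord j) i / j`!%:R)).[t]).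

Lemma coord_perturb g A E i : coord (perturb g A E) i =
  coord g i \+ horner (\poly_(j < k.+1) ((E - A) (inord j) i / j`!%:R)).
Proof. by apply/funext => t; rewrite /coord /perturb mxE. Qed.

Lemma smooth_perturb g A E : smooth_curve g -> smooth_curve (perturb g A E).
Proof.
move=> sg i; rewrite coord_perturb.
exact: smooth_near0D (sg i) (smooth_near0_horner _).
Qed.

Lemma derive1n_perturb g A E m i : smooth_curve g ->
  derive1n m (coord (perturb g A E) i) 0 =
  derive1n m (coord g i) 0 + if (m < k.+1)%N then (E - A) (inord m) i else 0.
Proof.
move=> sg; rewrite coord_perturb derive1nD //; last exact: smooth_near0_horner.
congr (_ + _); rewrite derive1n_horner horner_coef0 coef_derivn addn0 ffactnn.
rewrite coef_poly; case: ifP => _; last by rewrite mul0rn.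
by rewrite -[LHS]mulr_natr mulfVK // pnatr_eq0 -lt0n fact_gt0.
Qed.

Lemma taylor_perturb g A E : smooth_curve g -> taylor k g = A ->
  taylor k (perturb g A E) = E.
Proof.
move=> sg gA; apply/matrixP => j i; rewrite mxE derive1n_perturb // ltn_ord.
have <- : A j i = derive1n j (coord g i) 0 by rewrite -gA mxE.
by rewrite inord_val mxE [(- A) j i]mxE addrCA subrr addr0.
Qed.

Lemma derivs_cvg_perturb g A m i : smooth_curve g ->
  derivs_cvg (nbhs A) m (fun E => coord (perturb g A E) i) (coord g i).
Proof.
move=> sg j _; under eq_fun do rewrite derive1n_perturb //.
suff H : (fun E => if (j < k.+1)%N then (E - A) (inord j) i else 0 : R) @ A -->
    (0 : R).
  have Ha := @cvg_cst R (derive1n j (coord g i) 0) _ (nbhs A) (nbhs_filter A).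
  have Hc := cvgD Ha H; rewrite addr0 in Hc; exact: Hc.
case: (j < k.+1)%N; last first.
  exact: (@cvg_cst R 0 _ (nbhs A) (nbhs_filter A)).
rewrite (_ : (fun E => _) = (fun E => E (inord j) i - A (inord j) i)); last first.
  by apply/funext => E; rewrite mxE [(- A) _ _]mxE.
have Ha := @cvg_cst R (A (inord j) i) _ (nbhs A) (nbhs_filter A).
have Hc := cvgB (@coord_continuous R k.+1 n (inord j) i A) Ha.
rewrite subrr in Hc; exact: Hc.
Qed.

End Perturbation.


(** * Jets of projected curves *)

Section ProjectedJets.
Context {R : realType}.
Implicit Types (g : R -> 'cV[R]_3).

Lemma near_velocity_neq0 {T : Type} (G : set_system T) {FG : Filter G} n
    (u : T -> R -> 'cV[R]_n) (h : R -> 'cV[R]_n) :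
  (forall i, derivs_cvg G 1 (fun e => coord (u e) i) (coord h i)) ->
  velocity h != 0 -> \forall e \near G, velocity (u e) != 0.
Proof.
move=> cu /eqP vh.
have [i vi] : exists i, velocity h i 0 != 0.
  apply/not_existsP => H; apply: vh; apply/matrixP => i j.
  rewrite (ord1 j) [RHS]mxE.
  by apply/eqP/negP => /negP; exact: H.
have vi' : derive1n 1 (coord h i) 0 != 0 by move: vi; rewrite mxE.
have ni : \forall e \near G, derive1n 1 (coord (u e) i) 0 != 0.
  exact: (cvgr_neq0 _ (cu i 1%N isT) vi').
apply: filterS ni => e ne; apply/eqP => /matrixP/(_ i 0); rewrite !mxE.
exact/eqP.
Qed.

Lemma regular_central_proj c g : transversal_curves c g ->
  regular_curve (central_proj c \o g).
Proof.
move=> tg; have [cg _] := tg; have [[sg _] /nbhs_singleton g0] := cg.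
split; last exact/(transversal_velocityP cg).
exact: smooth_curve_rational (central_proj_rational g0) sg.
Qed.

Lemma proj_jetE k c g : transversal_curves c g ->
  proj_jet k c (jet k g) = jet k (central_proj c \o g).
Proof.
move=> tg; have [[rg /nbhs_singleton g0] _] := tg.
exact: prolong_jet rg tg (central_proj_rational g0).
Qed.

(** The velocities of the curve and of its projection are both multiplied by phi'(0), which is
    nonzero. *)
Lemma transversal_comp c g (phi : R -> R) : diffeo_germ phi ->
  transversal_curves c g -> transversal_curves c (g \o phi).
Proof.
move=> dphi tg; have [cg _] := tg; have [[sg vg] /nbhs_singleton g0] := cg.
have p'0 := diffeo_germ_derive1_neq0 dphi.
have [_ [[p0 _] sp _ _ _]] := dphi.
have gp0 : offplane c ((g \o phi) 0) by rewrite /= p0.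
have sgp := smooth_curve_comp p0 sp sg.
have cgp : curve_in (offplane c) (g \o phi).
  split; last exact: offplane_near sgp gp0.
  by split=> //; rewrite velocity_comp // scaler_eq0 negb_or p'0.
apply/(transversal_velocityP cgp).
have [sw vw] := regular_central_proj tg.
by rewrite (velocity_comp p0 sp sw) scaler_eq0 negb_or p'0.
Qed.

Lemma taylorE n k (g : R -> 'cV[R]_n) j i :
  taylor k g j i = derive1n j (coord g i) 0.
Proof. by rewrite mxE. Qed.

Lemma contact_taylor n k (g d : R -> 'cV[R]_n) : taylor k g = taylor k d ->
  contact k g d.
Proof. by move=> gd; exists id; first exact: diffeo_germ_id. Qed.

(** [g] itself may fail to be transversal, since a jet of order 0 does not see velocities. A
    transversal representative of the jet is reparametrized to have the Taylor matrix of [g]. *)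
Lemma transversal_representative k c g : regular_curve g ->
  proj_jet_defined k c (jet k g) ->
  exists h, [/\ transversal_curves c h, taylor k h = taylor k g
    & jet k g = jet k h].
Proof.
move=> rg [_ [d [rd td gd _]]].
have [phi dphi H] := jet_contact rg (esym gd).
exists (d \o phi); have tdp := transversal_comp dphi td; split=> //.
have [[[sdp _] _] _] := tdp.
by apply: (jet_eq rg.1 sdp); apply: contact_taylor.
Qed.

(** Every matrix [E] near [A] is the Taylor matrix of a perturbation of one transversal curve [h];
    regularity, transversality and membership of the projected Taylor matrix in the open set [V]
    persist for [E] close to [A]. *)
Lemma proj_jet_open k c (D : set (set (R -> 'cV[R]_2))) : jet_open k D ->
  jet_open k (proj_jet_defined k c `&` proj_jet k c @^-1` D).
Proof.
rewrite /jet_open; set V := [set A | _] => oV.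
rewrite openE => A [g [rg gA [Dg /= DIg]]].
have [h [th hA gh]] := transversal_representative rg Dg.
rewrite gA in hA; rewrite gh proj_jetE // in DIg.
have [ch _] := th; have [[sh vh] /nbhs_singleton h0] := ch.
have [sw vw] := regular_central_proj th.
have rP := central_proj_rational h0.
pose u E := perturb h A E.
have su E : smooth_curve (u E) := smooth_perturb A E sh.
(* Order [k.+1] rather than [k] makes first derivatives available even when [k] is 0. *)
have cu i : derivs_cvg (nbhs A) k.+1 (fun E => coord (u E) i) (coord h i).
  exact: derivs_cvg_perturb.
have cPu i : derivs_cvg (nbhs A) k.+1
    (fun E => coord (central_proj c \o u E) i) (coord (central_proj c \o h) i).
  exact: (derivs_cvg_rational (FG := nbhs_filter A) su sh (rP i) cu).2.
have VA : V (taylor k (central_proj c \o h)).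
  by exists (central_proj c \o h); split=> //; exact: regular_central_proj.
have nV : \forall E \near A, V (taylor k (central_proj c \o u E)).
  have cT (j : 'I_k.+1) (i : 'I_2) : taylor k (central_proj c \o u E) j i
      @[E --> A] --> taylor k (central_proj c \o h) j i.
    rewrite taylorE; under eq_fun do rewrite taylorE.
    exact: cPu i j (ltnW (ltn_ord j)).
  have cvT := cvg_mx (FG := nbhs_filter A) cT.
  by apply: cvT; apply: open_nbhs_nbhs; split.
have nv : \forall E \near A, velocity (u E) != 0.
  have cu1 i := derivs_cvgW (ltn0Sn k) (cu i).
  exact: (near_velocity_neq0 (FG := nbhs_filter A) cu1 vh).
have nvP : \forall E \near A, velocity (central_proj c \o u E) != 0.
  have cPu1 i := derivs_cvgW (ltn0Sn k) (cPu i).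
  exact: (near_velocity_neq0 (FG := nbhs_filter A) cPu1 vw).
have n0 : \forall E \near A, offplane c (u E 0).
  have h0' : h 0 2 0 - c 2 0 != 0 by rewrite subr_eq0.
  have Ha := @cvg_cst R (c 2 0) _ (nbhs A) (nbhs_filter A).
  have nE : \forall E \near A, u E 0 2 0 - c 2 0 != 0.
    exact: (cvgr_neq0 _ (cvgB (cu 2 0%N isT) Ha) h0').
  by apply: filterS nE => E; rewrite subr_eq0.
rewrite /interior; near=> E.
have rE : regular_curve (u E) by split; [exact: su|near: E].
have E0 : offplane c (u E 0) by near: E.
have cE : curve_in (offplane c) (u E).
  by split; [exact: rE|exact: offplane_near (su E) E0].
have tE : transversal_curves c (u E).
  by apply/(transversal_velocityP cE); near: E.
(* Membership in [V] only provides some curve [d] with the same Taylor matrix as the projected one;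
   equal Taylor matrices give equal jets. *)
have [d [rd dE Dd]] : V (taylor k (central_proj c \o u E)) by near: E.
exists (u E); split=> //; first exact: taylor_perturb.
split; first by exists (jet k (central_proj c \o u E)), (u E).
have [sEw _] := regular_central_proj tE.
by rewrite /= proj_jetE // -(jet_eq rd.1 sEw (contact_taylor dE)).
Unshelve. all: by end_near. Qed.

End ProjectedJets.

(** * Invariance of the pulled-back function *)

Theorem theorem18 (R : realType) (k : nat) (c : 'cV[R]_3)
    (D : set (set (R -> 'cV[R]_2))) (I : set (R -> 'cV[R]_2) -> R)
    (hI : differential_invariant k [set: 'cV[R]_2] (PGL3 R) D I) :
  differential_invariant k (offplane c) (GL3_conj c)
    (proj_jet_defined k c `&` proj_jet k c @^-1` D)
    (I \o proj_jet k c).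
Proof.
have [_ oD invI] := hI; split.
- by move=> z [[w [g [rg [cg _] -> _]]] _]; exists g.
- exact: proj_jet_open.
(* Three curves appear: [g'] represents the jet and starts in the domain of the transformation, [g]
   is a transversal representative of the same jet, and [h] is a transversal representative of the
   transformed jet. *)
move=> _ _ [A AU <-] [_ [g' [rg' [_ g'A] -> _]]] [[_ [g [rg tg zg _]]]].
move=> /= Dw [[_ [h [rh th ah _]]]].
have [cg _] := tg; have [sg _] := rg; have [sh _] := rh.
have [_ /nbhs_singleton g0] := cg.
(* The domain condition concerns only the base point, so it passes from [g'] to [g]. *)
have g'0 := contact_at0 (jet_contact rg zg).
rewrite zg in Dw ah *; rewrite -g'0 in g'A.
have gA : defined_on_curve (LocalTransf
    [set p | offplane c p /\ offplane c (Ad_translation c A p)]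
    (Ad_translation c A)) g by [].
rewrite (prolong_jet k rg gA (Ad_translation_rational _ _ _)) in ah *.
rewrite /= ah !proj_jetE //; rewrite proj_jetE // in Dw.
have [B0 BE] := linfrac_central_proj g0 g'A.
set B := (_ *m invmx _) in B0 BE.
have rw := regular_central_proj tg.
have saw := smooth_curve_rational (Ad_translation_rational c A _) sg.
have cah := jet_contact rh ah.
have aw0 := contact_at0 cah.
have raw := central_proj_rational g'A.
have sPag := smooth_curve_rational raw saw.
have sPh := regular_central_proj th.
have nE : {near 0, central_proj c \o (Ad_translation c A \o g) =1
                   linfrac B \o (central_proj c \o g)}.
  have [_ ng] := cg.
  apply: filterS2 ng (offplane_near saw g'A) => t gt gAt.
  by rewrite /= (linfrac_central_proj gt gAt).2.
have sBw := smooth_curve_rational (linfrac_rational B0) rw.1.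
(* The transformed curve is not known to be transversal. Its contact with [h] suffices, because the
   projection is rational at their common base point. *)
have jE : jet k (central_proj c \o h) =
    jet k (linfrac B \o (central_proj c \o g)).
  rewrite -(jet_eq sPag sPh.1 (contact_rational raw saw sh cah)).
  exact: jet_eq sPag sBw (contact_taylor (taylor_near _ nE)).
rewrite jE => Dh.
have BU : B \in unitmx by rewrite !unitmx_mul shear_unit AU unitmx_inv shear_unit.
have GB : PGL3 R (LocalTransf [set p | linfrac_den B p != 0] (linfrac B)).
  by exists B.
have wB : defined_on_curve
    (LocalTransf [set p | linfrac_den B p != 0] (linfrac B))
    (central_proj c \o g) by [].
have pE := prolong_jet k rw wB (linfrac_rational B0).
(* The goal is now the invariance of [I] under the linear fractional map of [B], at the jet of the
   projected curve [central_proj c \o g]. *)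
rewrite -pE in Dh *.
apply: (invI _ _ GB _ Dw Dh).
by exists (jet k (linfrac B \o (central_proj c \o g))), (central_proj c \o g).
Qed.
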